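(* Let $f$ be a SOS-convex polynomial on $\mathbb{R}^n$. For $i=1,\ldots,m$, let $0\le t_i\le q_i$ be integers, let $g_i^{(r)}$, $r=0,1,\ldots,t_i$, be SOS-convex polynomials on $\mathbb{R}^n$, let $g_i^{(r)}$, $r=t_i+1,\ldots,q_i$, be affine functions on $\mathbb{R}^n$, and let $$\hat{\mathcal{V}}_i:=\{v_i\in\mathbb{R}^{q_i} : v_i^{(r)}\ge 0,\ r=1,\ldots,t_i,\ \|(v_i^{(1)},\ldots,v_i^{(t_i)})\|\le 1,\ \|(v_i^{(t_i+1)},\ldots,v_i^{(q_i)})\|\le 1\}.$$ Consider the problem $$(P^e)\quad\inf_{x\in\mathbb{R}^n}\Big\{f(x) : g_i^{(0)}(x)+\sum_{r=1}^{q_i}v_i^{(r)}g_i^{(r)}(x)\le 0\ \ \forall v_i\in\hat{\mathcal{V}}_i,\ i=1,\ldots,m\Big\}$$ and, for $k\in\mathbb{N}$, the relaxation problem $$(D_k^e)\quad\begin{array}{cl}\max\limits_{\mu,w_i^r}&\mu\\ \text{s.t.}& f+\sum\limits_{i=1}^m\sum\limits_{r=0}^{q_i}w_i^rg_i^{(r)}-\mu\in\Sigma^2_k,\\ &\|(w_i^1,\ldots,w_i^{t_i})\|\le w_i^0,\ \ \forall i=1,\ldots,m,\\ &\|(w_i^{t_i+1},\ldots,w_i^{q_i})\|\le w_i^0,\ \ \forall i=1,\ldots,m,\\ &w_i^r\ge 0,\ \ \forall r=0,1,\ldots,t_i,\ i=1,\ldots,m,\\ &\mu\in\mathbb{R},\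 w_i^r\in\mathbb{R},\ \ \forall r=t_i+1,\ldots,q_i,\ i=1,\ldots,m.\end{array}$$ Suppose that $$\Big\{x\in\mathbb{R}^n : g_i^{(0)}(x)+\sum_{r=1}^{q_i}v_i^{(r)}g_i^{(r)}(x)<0\ \ \forall v_i\in\hat{\mathcal{V}}_i,\ i=1,\ldots,m\Big\}\neq\emptyset.$$ Then $\inf(P^e)=\max(D^e_{k_0})$, where $k_0$ is the smallest even number such that $k_0\ge\max_{0\le r\le q_i,\,1\le i\le m}\{\deg f,\deg g_i^{(r)}\}$.
   Context: A matrix polynomial $M\in\mathbb{R}[x]^{n\times n}$ is a SOS matrix polynomial if $M(x)=H(x)H(x)^T$ for some matrix polynomial $H\in\mathbb{R}[x]^{n\times r}$, $r\in\mathbb{N}$. A real polynomial $f$ on $\mathbb{R}^n$ is SOS-convex if its Hessian $x\mapsto\nabla^2 f(x)$ is a SOS matrix polynomial. $\Sigma^2_d$ denotes the set of all real polynomials of degree at most $d$ that are sums of squares of real polynomials. $\|\cdot\|$ is the Euclidean norm (the norm of an empty tuple is $0$). Writing ''max'' means that the supremum is attained when it is finite; if the relaxation problem has no feasible point its value is $-\infty$ by convention. *)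

(* Defs.v *)
From mathcomp Require Import all_boot all_order all_algebra.
From mathcomp Require Import classical_sets reals constructive_ereal ereal.
(* Without notations: those of mpoly clash with mathcomp-analysis. *)
From mathcomp Require Import -(notations) mpoly.

Set Implicit Arguments.
Unset Strict Implicit.
Unset Printing Implicit Defensive.

Import Order.TTheory GRing.Theory Num.Theory.

Local Open Scope classical_set_scope.
Local Open Scope ring_scope.

Section Polynomials.
Context {R : realType} {n : nat}.
Implicit Types (p : mpoly n R) (x : 'rV[R]_n).

Definition peval p x : R := meval (fun j => x 0 j) p.

(* [msize] is the degree plus one, and [msize 0 = 0]; hence [pdeg 0 = 0]. *)
Definition pdeg p : nat := (msize p).-1.

Definition affine p : Prop :=
  exists (a : 'rV[R]_n) (b : R), forall x, peval p x = \sum_j a 0 j * x 0 j + b.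

Definition is_sos p : Prop :=
  exists s : seq (mpoly n R), p = \sum_(h <- s) h ^+ 2.

(* The cone $\Sigma^2_k$. *)
Definition Sigma2 (k : nat) : set (mpoly n R) :=
  [set p | (pdeg p <= k)%N /\ is_sos p].

Definition sos_matrix (M : 'M[mpoly n R]_n) : Prop :=
  exists (r : nat) (H : 'M[mpoly n R]_(n, r)), M = H *m H^T.

Definition hessian p : 'M[mpoly n R]_n :=
  \matrix_(i, j) mderiv i (mderiv j p).

Definition sos_convex p : Prop := sos_matrix (hessian p).

End Polynomials.

(* Euclidean norm of the subtuple of [v] indexed by [P]. *)
Definition norm_on {R : realType} {N : nat} (P : pred 'I_N) (v : 'rV[R]_N) : R :=
  Num.sqrt (\sum_(r | P r) v 0 r ^+ 2).

(* The component $v^{(r)}$, $1 \le r \le q$, is [v 0 r'] with [r' = r - 1]: the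
   condition $r \le t$ reads [r' < t]. *)
Definition Vhat {R : realType} (t q : nat) : set 'rV[R]_q :=
  [set v : 'rV[R]_q |
    [/\ forall r : 'I_q, (r < t)%N -> 0 <= v 0 r,
        norm_on (fun r : 'I_q => (r < t)%N) v <= 1
      & norm_on (fun r : 'I_q => (t <= r)%N) v <= 1]].

(* $g^{(0)}(x) + \sum_{r=1}^q v^{(r)} g^{(r)}(x)$; [lift ord0 r] is the
   successor of [r]. *)
Definition uncertain {R : realType} {n q : nat} (g : 'I_q.+1 -> mpoly n R)
    (v : 'rV[R]_q) (x : 'rV[R]_n) : R :=
  peval (g ord0) x + \sum_(r < q) v 0 r * peval (g (lift ord0 r)) x.

Section RobustProblem.
Context {R : realType} {n m : nat}.
Variables (f : mpoly n R) (t q : 'I_m -> nat).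
Variable g : forall i : 'I_m, 'I_(q i).+1 -> mpoly n R.

Definition primal_feasible : set 'rV[R]_n :=
  [set x : 'rV[R]_n | forall (i : 'I_m) (v : 'rV[R]_(q i)),
     Vhat (t i) v -> uncertain (@g i) v x <= 0].

Definition primal_strictly_feasible : set 'rV[R]_n :=
  [set x : 'rV[R]_n | forall (i : 'I_m) (v : 'rV[R]_(q i)),
     Vhat (t i) v -> uncertain (@g i) v x < 0].

Definition primal_inf : \bar R :=
  ereal_inf [set (peval f x)%:E | x in primal_feasible].

(* Here [w i 0 r] is $w_i^r$ with the same index $0 \le r \le q_i$. *)
Definition dual_feasible (k : nat) (mu : R) (w : forall i, 'rV[R]_(q i).+1) :
    Prop :=
  [/\ Sigma2 k (f + \sum_(i < m) \sum_(r < (q i).+1) w i 0 r *: g r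
                - mpolyC n mu),
      forall i, norm_on (fun r : 'I_(q i).+1 => (0 < r <= t i)%N) (w i)
                  <= w i 0 ord0,
      forall i, norm_on (fun r : 'I_(q i).+1 => (t i < r)%N) (w i)
                  <= w i 0 ord0
    & forall i (r : 'I_(q i).+1), (r <= t i)%N -> 0 <= w i 0 r].

Definition dual_values (k : nat) : set R :=
  [set mu | exists w, dual_feasible k mu w].

(* Equal to $-\infty$ when there is no feasible point. *)
Definition dual_sup (k : nat) : \bar R :=
  ereal_sup [set mu%:E | mu in dual_values k].

(* The supremum is attained when it is finite. *)
Definition dual_is_max (k : nat) : Prop :=
  dual_sup k \is a fin_num ->
  exists2 mu, dual_values k mu & dual_sup k = mu%:E.

Definition max_degree : nat :=
  maxn (pdeg f) (\max_(i < m) \max_(r < (q i).+1) pdeg (g r)).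

End RobustProblem.

Definition smallest_even_ge (d k : nat) : Prop :=
  [/\ ~~ odd k, (d <= k)%N
    & forall l : nat, ~~ odd l -> (d <= l)%N -> (k <= l)%N].

(* Main.v *)
From HB Require Import structures.
Require Import Defs.
From mathcomp Require Import all_boot all_order all_algebra.
From mathcomp Require Import boolp classical_sets reals constructive_ereal ereal.
From mathcomp Require Import filter topology normedtype.
From mathcomp Require Import -(notations) mpoly.
From mathcomp Require Import polyrcf ring lra zify.

Set Implicit Arguments.
Unset Strict Implicit.
Unset Printing Implicit Defensive.

Import Order.TTheory GRing.Theory Num.Theory.
Import numFieldNormedType.Exports.

Local Open Scope classical_set_scope.
Local Open Scope ring_scope.

Local Notation "p @_ m" := (mcoeff m p) (at level 3, m at level 2).
Local Notation "''X_[' m ]" := (mpolyX _ m) (at level 8, format "''X_[' m ]").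
Local Notation "''X_' i" := (mpolyX _ (mnm1 i)) (at level 8, i at level 2).

(** The proof combines convex duality with the fact that a nonnegative
    SOS-convex polynomial is a sum of squares.

    Duality.  Pairing a vector [b] of constraint values with [(1, v)], for [v]
    in the uncertainty set, shows that the robust constraint asks [b] to lie in
    a convex cone [worst_le0], and that the norm constraints of the relaxation
    describe exactly its polar cone [dual_cone] ([dual_cone_ray],
    [dual_coneP]).  If [c] is a lower bound of [f] on the feasible set, the
    convex cone [epi_cone], spanned by the points lying above the values of
    [f - c] and of the constraints, does not contain 0.  A separating
    hyperplane gives multipliers, and the Slater point forces the weight of
    the objective to be positive.  So there is a dual weight [w] whose
    Lagrangian is at least [c] on the whole space ([lagrange_multipliers]).

    Sums of squares.  The Lagrangian is SOS-convex: the affine constraints,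
    whose weights have no sign, have a zero Hessian.  It remains to see that an
    SOS-convex [p >= 0] is a sum of squares ([sos_convex_ge0_is_sos]).  Since
    [p] is convex and polynomial it attains its infimum at some [y]
    ([sos_convex_attains_min]), where the gradient vanishes; and [p] minus its
    first-order expansion at any point is a sum of squares
    ([is_sos_sub_tangent]).  The last fact is the usual integral remainder
    [int_0^1 (1 - s) |H(y + s z)^T z|^2 ds]; integrating out [s] leaves the
    kernel [1 / ((i + j) (i + j - 1))] on homogeneous components, which is a
    product of two Cauchy kernels and hence an explicit Gram kernel
    ([gram_on_cauchy]).

    The degree bound holds because the Lagrangian has degree at most that of
    the data.  Hence every finite primal value is itself a feasible dual value;
    together with weak duality this gives both the equality and the attainment.

    Limits in compact sets are taken coordinatewise along an ultrafilter, along
    which every bounded real family converges; this serves both the attainment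
    of the minimum and the passage from finitely many to all half-spaces in
    the separation theorem. *)

(** * Cauchy kernels *)

(** Positive semidefiniteness on [s], in the form that produces squares: a sum of
    kernels of rank one. *)
Definition gram_on {R : realType} {T : eqType} (s : seq T) (K : T -> T -> R) :=
  exists cs : seq (T -> R),
    {in s &, forall i j, K i j = \sum_(c <- cs) c i * c j}.

(** This is the Cholesky factorization of a Cauchy matrix: subtracting
    [2 x / ((a i + x) (a j + x))] from [1 / (a i + a j)] multiplies it by
    [(a i - x) (a j - x) / ((a i + x) (a j + x))], which kills the row and the
    column of [x] and keeps the Cauchy form elsewhere. *)
Lemma gram_on_cauchy (R : realType) (T : eqType) (s : seq T) (a : T -> R) :
  {in s, forall i, 0 < a i} -> gram_on s (fun i j => (a i + a j)^-1).
Proof.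
elim: s => [|x s IHs] a_gt0; first by exists [::].
have [i si|cs csE] := IHs; first by apply: a_gt0; rewrite inE si orbT.
have ax_gt0 : 0 < a x by apply: a_gt0; rewrite mem_head.
exists ((fun i => Num.sqrt (2 * a x) / (a i + a x))
  :: [seq fun i => c i * ((a i - a x) / (a i + a x)) | c <- cs]).
move=> i j xsi xsj; rewrite big_cons big_map.
have ai_gt0 := a_gt0 _ xsi; have aj_gt0 := a_gt0 _ xsj.
have -> : Num.sqrt (2 * a x) / (a i + a x) * (Num.sqrt (2 * a x) / (a j + a x))
    = 2 * a x / ((a i + a x) * (a j + a x)).
  rewrite mulrACA -expr2 sqr_sqrtr ?invfM //; lra.
under eq_bigr do rewrite mulrACA.
rewrite -mulr_suml.
move: xsi xsj; rewrite !inE => /predU1P[->|si].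
  move=> _; rewrite subrr !mul0r mulr0 addr0; field.
  by rewrite ?lt0r_neq0 //; lra.
move=> /predU1P[->|sj].
  rewrite subrr mul0r !mulr0 addr0; field.
  by rewrite ?lt0r_neq0 //; lra.
by rewrite -csE //; field; rewrite ?lt0r_neq0 //; lra.
Qed.

(** The Schur product theorem, read on explicit Gram vectors. *)
Lemma gram_on_mul (R : realType) (T : eqType) (s : seq T) (K L : T -> T -> R) :
  gram_on s K -> gram_on s L -> gram_on s (fun i j => K i j * L i j).
Proof.
move=> [cs csE] [ds dsE].
exists [seq (fun i => c i * d i) | c <- cs, d <- ds] => i j si sj.
rewrite big_allpairs_dep csE // dsE // big_distrl /=.
apply: eq_bigr => c _; rewrite big_distrr /=.
by apply: eq_bigr => d _; rewrite mulrACA.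
Qed.

(** * Sums of squares *)

Lemma sum_sqr_le0 (R : realType) (I : finType) (P : pred I) (u : I -> R) :
  \sum_(r | P r) u r ^+ 2 <= 0 -> forall r, P r -> u r = 0.
Proof.
move=> le0 r Pr; apply/eqP; rewrite -sqrf_eq0; apply/eqP.
have sum0 : \sum_(r | P r) u r ^+ 2 = 0.
  by apply/eqP; rewrite eq_le le0 sumr_ge0 // => i _; exact: sqr_ge0.
exact: (psumr_eq0P (fun i _ => sqr_ge0 (u i)) sum0).
Qed.

Section SumsOfSquares.
Context {R : realType} {n : nat}.
Implicit Types p q : mpoly n R.

Lemma is_sos0 : is_sos (0 : mpoly n R).
Proof. by exists [::]; rewrite big_nil. Qed.

Lemma is_sosD p q : is_sos p -> is_sos q -> is_sos (p + q).
Proof. by move=> [s ->] [s' ->]; exists (s ++ s'); rewrite big_cat. Qed.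

Lemma is_sos_sum (I : Type) (r : seq I) (F : I -> mpoly n R) :
  (forall i, is_sos (F i)) -> is_sos (\sum_(i <- r) F i).
Proof. by move=> sosF; elim/big_ind: _ => //; [exact: is_sos0 | exact: is_sosD]. Qed.

Lemma is_sosC (c : R) : 0 <= c -> is_sos (mpolyC n c).
Proof.
move=> c_ge0; exists [:: mpolyC n (Num.sqrt c)].
by rewrite big_seq1 expr2 -mpolyCM -expr2 sqr_sqrtr.
Qed.

Lemma peval_sos_ge0 p x : is_sos p -> 0 <= peval p x.
Proof.
move=> [s ->]; rewrite /peval raddf_sum sumr_ge0 // => h _.
by rewrite /= expr2 mevalM -expr2 sqr_ge0.
Qed.

Lemma is_sos_gram (T : eqType) (s : seq T) (K : T -> T -> R) (v : T -> mpoly n R) :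
  gram_on s K ->
  is_sos (\sum_(i <- s) \sum_(j <- s) K i j *: (v i * v j)).
Proof.
move=> [cs csE]; exists [seq \sum_(i <- s) c i *: v i | c <- cs].
rewrite big_map; under [RHS]eq_bigr do rewrite expr2 big_distrlr /=.
rewrite [RHS]exchange_big /=; apply: eq_big_seq => i si.
rewrite [RHS]exchange_big /=; apply: eq_big_seq => j sj.
rewrite csE // scaler_suml; apply: eq_bigr => c _.
by rewrite -scalerAl -scalerAr scalerA.
Qed.

End SumsOfSquares.

(** * First-order expansion of SOS-convex polynomials *)

Section Taylor.
Context {R : realType} {n : nat}.
Implicit Types p q : mpoly n R.

Lemma mderivXU (i j : 'I_n) : mderiv i 'X_j = mpolyC n (i == j)%:R :> mpoly n R.
Proof.
rewrite mderivX mnm1E eq_sym; case: eqVneq => [->|_]; last by rewrite scale0r mpolyC0.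
have -> : mnm_sub (mnm1 j) (mnm1 j) = @mnm0 n.
  by apply/mnmP => l; rewrite mnmBE mnm0E subnn.
by rewrite scale1r mpolyX0 mpolyC1.
Qed.

Lemma mnm_neq0P (m : multinom n) : m <> mnm0 -> exists i, m i != 0%N.
Proof.
move=> m_neq0; apply/existsP; rewrite -negb_forall; apply/forallP => m0.
by apply: m_neq0; apply/mnmP => i; rewrite mnm0E; apply/eqP.
Qed.

(** A weight depending on the degree turns [u ^ 2] into a quadratic form in the
    terms of [u], whose coefficients are the kernel values; a Gram kernel makes
    this form a sum of squares. *)
Lemma is_sos_weighted_square (w : nat -> R) (u : mpoly n R) :
  gram_on (msupp u) (fun a b => w (mdeg a + mdeg b)%N) ->
  exists q, is_sos q /\ forall m, q@_m = w (mdeg m) * (u ^+ 2)@_m.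
Proof.
move=> gram_w.
pose v m := u@_m *: 'X_[m].
exists (\sum_(a <- msupp u) \sum_(b <- msupp u)
          w (mdeg a + mdeg b)%N *: (v a * v b)); split; first exact: is_sos_gram.
move=> m; rewrite {3}(mpolyE u) expr2 big_distrlr /=.
rewrite !raddf_sum mulr_sumr; apply: eq_bigr => a _ /=.
rewrite !raddf_sum mulr_sumr; apply: eq_bigr => b _ /=.
rewrite mcoeffZ /v -scalerAl -scalerAr -mpolyXD !mcoeffZ mcoeffX.
have [<-|_] := eqVneq; first by rewrite mdegD.
by rewrite !mulr0.
Qed.

Definition euler p : mpoly n R := \sum_i 'X_i * mderiv i p.

Lemma mcoeff_euler p m : (euler p)@_m = (mdeg m)%:R * p@_m.
Proof.
have eulerX k : euler 'X_[k] = (mdeg k)%:R *: 'X_[k].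
  rewrite /euler mdegE natr_sum scaler_suml; apply: eq_bigr => i _.
  rewrite mderivX -scalerAr -mpolyXD.
  have [k0|k_neq0] := eqVneq (k i) 0%N; first by rewrite k0 !scale0r.
  congr (_ *: 'X_[_]); apply/mnmP => j; rewrite mnmDE mnmBE mnm1E.
  by case: eqVneq => [<-|_]; rewrite ?subn0 // subnKC // lt0n.
have -> : euler p = \sum_(k <- msupp p) p@_k *: euler 'X_[k].
  rewrite {1}(mpolyE p) /euler.
  under eq_bigr do rewrite raddf_sum mulr_sumr.
  rewrite exchange_big /=; apply: eq_bigr => k _.
  rewrite scaler_sumr; apply: eq_bigr => i _.
  by rewrite mderivZ scalerAr.
rewrite {3}(mpolyE p) raddf_sum [X in _ * X]raddf_sum /= mulr_sumr.
apply: eq_bigr => k _ /=.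
rewrite eulerX !mcoeffZ mcoeffX; case: eqVneq => [->|_]; last by rewrite !mulr0.
by rewrite mulrCA.
Qed.

(** Both sides multiply the degree [d] component by [d (d - 1)]; going through
    the first-order operator avoids handling second derivatives of monomials. *)
Lemma hessian_form_euler p :
  \sum_i \sum_j 'X_i * 'X_j * hessian p i j = euler (euler p) - euler p.
Proof.
rewrite /euler -sumrB; apply: eq_bigr => i _.
rewrite raddf_sum mulr_sumr /=.
have -> : 'X_i * mderiv i p = \sum_j ('X_i * (mderiv i 'X_j * mderiv j p)).
  rewrite (bigD1 i) //= mderivXU eqxx mpolyC1 mul1r big1 ?addr0 // => j ji.
  by rewrite mderivXU eq_sym (negPf ji) mpolyC0 mul0r mulr0.
rewrite -sumrB; apply: eq_bigr => j _.
by rewrite mxE mderivM mulrDr addrC addKr mulrA.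
Qed.

Lemma mcoeff_hessian_form p m :
  (\sum_i \sum_j 'X_i * 'X_j * hessian p i j)@_m
  = (mdeg m)%:R * ((mdeg m)%:R - 1) * p@_m.
Proof.
rewrite hessian_form_euler raddfB /= !mcoeff_euler; ring.
Qed.

Lemma sos_hessian_form p (r : nat) (H : 'M[mpoly n R]_(n, r)) :
  hessian p = H *m H^T ->
  \sum_i \sum_j 'X_i * 'X_j * hessian p i j
  = \sum_l (\sum_i 'X_i * H i l) ^+ 2.
Proof.
move=> ->.
under [RHS]eq_bigr do rewrite expr2 big_distrlr /=.
rewrite [RHS]exchange_big /=; apply: eq_bigr => i _.
rewrite [RHS]exchange_big /=; apply: eq_bigr => j _.
rewrite mxE mulr_sumr; apply: eq_bigr => l _.
by rewrite mxE mulrACA.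
Qed.

(** With [d = deg a + deg b], both [1 / d] and [1 / (d - 1)] are Cauchy kernels,
    for the nodes [deg] and [deg - 1/2]; these are positive because [u] has no
    constant term. *)
Lemma gram_on_degree_weight (u : mpoly n R) :
  u@_mnm0 = 0 ->
  gram_on (msupp u) (fun a b =>
    ((mdeg a + mdeg b)%:R * ((mdeg a + mdeg b)%:R - 1) : R)^-1).
Proof.
move=> u0.
have deg_ge1 : {in msupp u, forall a, 1 <= (mdeg a)%:R :> R}.
  move=> a; rewrite mcoeff_msupp => ua; rewrite ler1n lt0n mdeg_eq0.
  by apply: contraNneq ua => ->; rewrite u0.
have [||cs csE] := @gram_on_mul R _ (msupp u)
  (fun a b => ((mdeg a)%:R + (mdeg b)%:R)^-1)
  (fun a b => (((mdeg a)%:R - 2^-1) + ((mdeg b)%:R - 2^-1))^-1).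
- by apply: gram_on_cauchy => a /deg_ge1; lra.
- by apply: (gram_on_cauchy (a := fun a => (mdeg a)%:R - 2^-1)) => a /deg_ge1; lra.
exists cs => a b sa sb; rewrite -csE // natrD invfM; congr (_ * _^-1); lra.
Qed.

Definition tangent p (y : 'rV[R]_n) : mpoly n R :=
  mpolyC n (peval p y)
  + \sum_j peval (mderiv j p) y *: ('X_j - mpolyC n (y 0 j)).

Lemma peval0 p : peval p 0 = p@_mnm0.
Proof.
rewrite /peval mevalE [in RHS](mpolyE p) raddf_sum; apply: eq_bigr => m _ /=.
rewrite mcoeffZ mcoeffX; congr (_ * _).
have [->|/eqP/mnm_neq0P[i mi]] := eqVneq m mnm0.
  by rewrite big1 // => i _; rewrite mnm0E expr0.
apply/eqP; rewrite prodf_seq_eq0; apply/hasP.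
by exists i; rewrite ?mem_index_enum // mxE /= expf_eq0 lt0n mi eqxx.
Qed.

Lemma mcoeff_sub_tangent0 p m :
  (p - tangent p 0)@_m = if (mdeg m <= 1)%N then 0 else p@_m.
Proof.
rewrite /tangent mcoeffB mcoeffD (raddf_sum (mcoeff m)) mcoeffC peval0 /=.
have -> : \sum_j (peval (mderiv j p) 0 *: ('X_j - mpolyC n ((0 : 'rV[R]_n) 0 j)))@_m
    = \sum_j p@_(mnm1 j) * (mnm1 j == m)%:R.
  apply: eq_bigr => j _; rewrite mxE mcoeffZ raddfB /= mcoeffX mcoeffC mul0r subr0.
  rewrite peval0 mcoeff_mderiv mnm0E mulr1n; congr (p@_ _ * _).
  by apply/mnmP => i; rewrite mnmDE mnm0E add0n.
case: ifP => [|/negbT].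
  rewrite leq_eqVlt ltnS leqn0 => /orP[/mdeg1P[i /eqP ->]|].
    rewrite (bigD1 i) //= eqxx mulr1 big1 ?addr0; last first.
      move=> j ji; rewrite (_ : (_ == _) = false) ?mulr0 //.
      apply: contra_neqF ji => /eqP/(congr1 (fun k : multinom n => k i)).
      by rewrite !mnm1E eqxx; case: eqVneq.
    by rewrite -mdeg_eq0 mdeg1 mulr0 add0r subrr.
  rewrite mdeg_eq0 => /eqP ->; rewrite eqxx mulr1 big1 ?addr0 ?subrr // => j _.
  by rewrite -mdeg_eq0 mdeg1 mulr0.
rewrite -ltnNge => m_gt1; rewrite -mdeg_eq0 gtn_eqF ?mulr0 ?add0r; last lia.
rewrite big1 ?subr0 // => j _; rewrite (_ : (_ == _) = false) ?mulr0 //.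
by apply: contraTF m_gt1 => /eqP <-; rewrite mdeg1.
Qed.

(** The form [z^T (hess p) z] multiplies the degree [d] component of [p] by
    [d (d - 1)] and is the sum of the squares of the entries of [H^T z]; dividing
    these coefficients by [d (d - 1)] recovers [p] without its terms of degree at
    most 1. *)
Lemma is_sos_sub_tangent0 p : sos_convex p -> is_sos (p - tangent p 0).
Proof.
move=> [r [H HE]].
pose u l : mpoly n R := \sum_i 'X_i * H i l.
pose w d : R := (d%:R * (d%:R - 1))^-1.
have u0 l : (u l)@_mnm0 = 0.
  rewrite -peval0 /peval raddf_sum big1 // => i _ /=.
  by rewrite mevalM mevalXU mxE mul0r.
have sosW l : exists q, is_sos q /\ forall m, q@_m = w (mdeg m) * (u l ^+ 2)@_m.
  by apply: is_sos_weighted_square; exact: gram_on_degree_weight.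
have [q qP] := boolp.choice sosW.
have -> : p - tangent p 0 = \sum_l q l.
  apply/mpolyP => m; rewrite mcoeff_sub_tangent0 raddf_sum /=.
  under eq_bigr do rewrite (qP _).2.
  rewrite -mulr_sumr -raddf_sum -(sos_hessian_form HE) /=.
  rewrite mcoeff_hessian_form /w.
  case: ifP => [|/negbT].
    by case: (mdeg m) => [|[|//]] _; rewrite ?mulr0n ?mulr1n ?subrr ?mulr0 !mul0r ?mulr0.
  rewrite -ltnNge => m_gt1; rewrite mulKf //.
  have : 1 < (mdeg m)%:R :> R by rewrite ltr1n.
  by move=> ?; rewrite mulf_neq0 // lt0r_neq0 //; lra.
by apply: is_sos_sum => l; exact: (qP l).1.
Qed.

End Taylor.

(** * Substitutions and convexity *)

Section Substitution.
Context {R : realType} {n : nat}.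
Implicit Types p q : mpoly n R.

Lemma mpoly_ring_ind (P : mpoly n R -> Prop) :
  (forall c, P (mpolyC n c)) -> (forall i, P 'X_i) ->
  (forall p q, P p -> P q -> P (p + q)) ->
  (forall p q, P p -> P q -> P (p * q)) ->
  forall p, P p.
Proof.
move=> PC PX PD PM; elim/mpolyind => [|c m p _ _ Pp].
  by rewrite -(mpolyC0 n R).
apply: (PD) => //; rewrite -mul_mpolyC; apply: (PM) => //.
rewrite mpolyXE_id; have P1 : P 1 by rewrite -(mpolyC1 n R).
apply: (big_ind P P1 PM) => i _.
elim: (m i) => [//|k IHk].
by rewrite exprS; apply: PM.
Qed.

(** The chain rule for a derivation [d] that kills the constants; the two cases
    of interest are a partial derivative of a translate and the derivative of
    the restriction to a line. *)
Lemma mmap_chain (A : comNzRingType) (f : {rmorphism R -> A}) (h : 'I_n -> A)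
    (d : {additive A -> A}) :
  (forall a b, d (a * b) = d a * b + a * d b) -> (forall c, d (f c) = 0) ->
  forall p, d (mmap f h p) = \sum_j mmap f h (mderiv j p) * d (h j).
Proof.
move=> dM dC; apply: mpoly_ring_ind => [c|i|p q IHp IHq|p q IHp IHq].
- rewrite mmapC dC big1 // => j _.
  by rewrite mderivC mmap0 mul0r.
- rewrite mmapX mmap1U (bigD1 i) //= big1 ?addr0 => [|j ji].
    by rewrite mderivXU eqxx mpolyC1 rmorph1 mul1r.
  by rewrite mderivXU (negPf ji) mpolyC0 mmap0 mul0r.
- rewrite mmapD raddfD /= IHp IHq -big_split; apply: eq_bigr => j _ /=.
  by rewrite mderivD mmapD mulrDl.
- rewrite rmorphM dM IHp IHq mulr_suml mulr_sumr -big_split.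
  apply: eq_bigr => j _ /=.
  rewrite mderivM mmapD !rmorphM /=; ring.
Qed.

Definition shift (y : 'rV[R]_n) : mpoly n R -> mpoly n R :=
  mmap (@mpolyC n R) (fun j => 'X_j + mpolyC n (y 0 j)).

HB.instance Definition _ y := GRing.RMorphism.on (shift y).

Lemma shiftC y c : shift y (mpolyC n c) = mpolyC n c.
Proof. exact: mmapC. Qed.

Lemma shiftX y j : shift y 'X_j = 'X_j + mpolyC n (y 0 j).
Proof. by rewrite /shift mmapX mmap1U. Qed.

Lemma shiftZ y c p : shift y (c *: p) = c *: shift y p.
Proof. by rewrite /shift mmapZ mul_mpolyC. Qed.

Lemma peval_shift y p x : peval (shift y p) x = peval p (x + y).
Proof.
elim/mpoly_ring_ind: p => [c|i|p q IHp IHq|p q IHp IHq].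
- by rewrite shiftC /peval !mevalC.
- by rewrite shiftX /peval mevalD mevalC !mevalXU mxE.
- by rewrite rmorphD /peval !mevalD; congr (_ + _).
- by rewrite rmorphM /peval !mevalM; congr (_ * _).
Qed.

Lemma shiftNK y : cancel (shift y) (shift (- y)).
Proof.
elim/mpoly_ring_ind => [c|i|p q IHp IHq|p q IHp IHq].
- by rewrite !shiftC.
- by rewrite shiftX rmorphD /= shiftC shiftX -addrA -mpolyCD mxE addNr mpolyC0 addr0.
- by rewrite !rmorphD /= IHp IHq.
- by rewrite !rmorphM /= IHp IHq.
Qed.

Lemma mderiv_shift y i p : mderiv i (shift y p) = shift y (mderiv i p).
Proof.
rewrite (@mmap_chain _ _ _ (mderiv i)) => [|a b|c].
- rewrite (bigD1 i) //= big1 ?addr0 => [|j ji].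
    by rewrite mderivD mderivXU mderivC eqxx mpolyC1 addr0 mulr1.
  by rewrite mderivD mderivXU mderivC eq_sym (negPf ji) mpolyC0 addr0 mulr0.
- exact: mderivM.
- exact: mderivC.
Qed.

Lemma sos_convex_shift y p : sos_convex p -> sos_convex (shift y p).
Proof.
move=> [r [H HE]]; exists r, (map_mx (shift y) H).
rewrite matrix.map_trmx -map_mxM -HE; apply/matrixP => i j.
by rewrite !mxE !mderiv_shift.
Qed.

Lemma is_sos_shift y p : is_sos p -> is_sos (shift y p).
Proof.
move=> [s ->]; exists [seq shift y h | h <- s].
by rewrite big_map rmorph_sum; apply: eq_bigr => h _; rewrite rmorphXn.
Qed.

Lemma shift_tangent p y : shift (- y) (tangent (shift y p) 0) = tangent p y.
Proof.
rewrite /tangent rmorphD /= shiftC peval_shift add0r; congr (_ + _).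
rewrite rmorph_sum; apply: eq_bigr => j _ /=.
rewrite shiftZ mderiv_shift peval_shift add0r rmorphB /= shiftX shiftC.
by rewrite !mxE mpolyC0 subr0 mpolyCN.
Qed.

Lemma is_sos_sub_tangent p y : sos_convex p -> is_sos (p - tangent p y).
Proof.
move=> /(sos_convex_shift y)/is_sos_sub_tangent0/(is_sos_shift (- y)).
by rewrite rmorphB /= shiftNK shift_tangent.
Qed.

Definition dirder p (y d : 'rV[R]_n) : R := \sum_j peval (mderiv j p) y * d 0 j.

Lemma peval_tangent p y x :
  peval (tangent p y) x = peval p y + dirder p y (x - y).
Proof.
rewrite {1}/peval /tangent mevalD mevalC raddf_sum; congr (_ + _).
apply: eq_bigr => j _ /=.
by rewrite mevalZ mevalB mevalXU mevalC !mxE.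
Qed.

Lemma sos_convex_tangent_le p y x :
  sos_convex p -> peval p y + dirder p y (x - y) <= peval p x.
Proof.
move=> /(is_sos_sub_tangent y)/(peval_sos_ge0 x).
by rewrite {1}/peval mevalB subr_ge0 -/(peval _ _) peval_tangent.
Qed.

Lemma dirderZ p y a d : dirder p y (a *: d) = a * dirder p y d.
Proof. by rewrite mulr_sumr; apply: eq_bigr => j _; rewrite mxE mulrCA. Qed.

Lemma dirderN p y d : dirder p y (- d) = - dirder p y d.
Proof. by rewrite -scaleN1r dirderZ mulN1r. Qed.

(** Both tangent inequalities at the barycentre are combined, which makes the
    first-order terms cancel. *)
Lemma sos_convex_le p x y (a b : R) : sos_convex p -> 0 <= a -> 0 <= b ->
  a + b = 1 -> peval p (a *: x + b *: y) <= a * peval p x + b * peval p y.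
Proof.
move=> cvxp a_ge0 b_ge0 ab1; set z := _ + _.
have bE : b = 1 - a by lra.
have /(ler_wpM2l a_ge0) := sos_convex_tangent_le z x cvxp.
have /(ler_wpM2l b_ge0) := sos_convex_tangent_le z y cvxp.
have -> : x - z = b *: (x - y).
  by rewrite /z bE; apply/rowP => j; rewrite !mxE; ring.
have -> : y - z = - (a *: (x - y)).
  by rewrite /z bE; apply/rowP => j; rewrite !mxE; ring.
rewrite dirderN !dirderZ => le_y le_x.
have -> : peval p z = a * peval p z + b * peval p z by rewrite -mulrDl ab1 mul1r.
lra.
Qed.

Definition line p (x d : 'rV[R]_n) : {poly R} :=
  mmap polyC (fun j => (x 0 j)%:P + d 0 j *: 'X) p.

Lemma horner_line p x d s : (line p x d).[s] = peval p (x + s *: d).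
Proof.
elim/mpoly_ring_ind: p => [c|i|p q IHp IHq|p q IHp IHq].
- by rewrite /line mmapC hornerC /peval mevalC.
- by rewrite /line mmapX mmap1U !hornerE /peval mevalXU !mxE mulrC.
- by rewrite /line mmapD hornerD IHp IHq /peval mevalD.
- by rewrite /line rmorphM hornerM IHp IHq /peval mevalM.
Qed.

Lemma deriv_line p x d :
  (line p x d)^`() = \sum_j d 0 j *: line (mderiv j p) x d.
Proof.
rewrite (@mmap_chain _ _ _ (@deriv R)) => [|a b|c].
- apply: eq_bigr => j _.
  by rewrite /= derivD derivC add0r derivZ derivX alg_polyC mulrC mul_polyC.
- exact: derivM.
- exact: derivC.
Qed.

End Substitution.

Lemma poly_vanishing (R : realType) (p : {poly R}) :
  (forall s, p.[s] = 0) -> p = 0.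
Proof.
move=> p0; apply/eqP; apply: contraT => p_neq0.
have := @max_poly_roots _ p [seq i%:R | i <- iota 0 (size p)] p_neq0.
rewrite size_map size_iota ltnn => -> //.
  by apply/allP => s _; rewrite rootE p0.
by rewrite map_inj_uniq ?iota_uniq // => i j /eqP; rewrite eqr_nat => /eqP.
Qed.

(** Otherwise [p ^ 2 - B ^ 2] would have a positive leading coefficient and so
    become positive. *)
Lemma poly_bounded_const (R : realType) (p : {poly R}) (B : R) :
  (forall s, 0 <= s -> `|p.[s]| <= B) -> forall s, p.[s] = p.[0].
Proof.
move=> pB; have [/size1_polyC -> s|p_gt1] := leqP (size p) 1.
  by rewrite !hornerC.
have B_ge0 : 0 <= B by apply: le_trans (pB 0 _).
pose q := p ^+ 2 - (B ^+ 2)%:P.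
have size_sqr : (1 < size (p ^+ 2)%R)%N.
  have := size_exp p 2; move: p_gt1; case: (size p) => [|[|k]] // _.
  by case: (size _) => [|[|l]].
have lead_q : lead_coef q = lead_coef p ^+ 2.
  rewrite lead_coefDl ?lead_coef_exp // size_polyN.
  exact: leq_ltn_trans (size_polyC_leq1 _) _.
have lead_q_gt0 : 0 < lead_coef q.
  by rewrite lead_q exprn_even_gt0 //= lead_coef_eq0 -size_poly_gt0; exact: ltnW.
have [x qx] := poly_pinfty_gt_lc lead_q_gt0.
have := qx (Num.max x 0); rewrite le_max lexx => /(_ isT).
have := pB (Num.max x 0); rewrite le_max lexx orbT => /(_ isT).
rewrite /q !hornerE => pxB /(lt_le_trans lead_q_gt0).
by rewrite subr_gt0 -(real_normK (num_real p.[_])) ltr_sqr ?nnegrE // ltNge pxB.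
Qed.

Section Vanishing.
Context {R : realType} {n : nat}.
Implicit Types p q : mpoly n R.

(** Partial derivatives of an everywhere vanishing polynomial vanish everywhere,
    and the coefficient at [m] is, up to a nonzero factor, a constant
    coefficient of a derivative of order [mdeg m]. *)
Lemma peval_inj p q : (forall x, peval p x = peval q x) -> p = q.
Proof.
move=> pq; apply/eqP; rewrite -subr_eq0; apply/eqP/mpolyP => m.
rewrite mcoeff0; have {pq} : forall x, peval (p - q) x = 0.
  by move=> x; rewrite /peval mevalB [meval _ p]pq subrr.
move: (p - q) => {p q}.
have [k] := ubnP (mdeg m); elim: k m => // k IHk m; rewrite ltnS => m_le p p0.
have [->|/eqP/mnm_neq0P[i mi]] := eqVneq m mnm0; first by rewrite -peval0.
have mE : m = mnm_add (mnm_sub m (mnm1 i)) (mnm1 i).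
  apply/mnmP => j; rewrite mnmDE mnmBE mnm1E subnK //.
  by case: eqVneq => [<-|//]; rewrite lt0n.
have := IHk (mnm_sub m (mnm1 i)) _ (mderiv i p).
rewrite mcoeff_mderiv -mE => /(_ _ _)/eqP; rewrite mulrn_eq0 /= => dp0.
apply/eqP; apply: dp0.
  by move: m_le; rewrite {1}mE mdegD mdeg1 addn1.
move=> x; have line0 : line p x (delta_mx 0 i) = 0.
  by apply: poly_vanishing => s; rewrite horner_line p0.
have := deriv_line p x (delta_mx 0 i); rewrite line0 deriv0.
rewrite (bigD1 i) //= big1 ?addr0 => [/(congr1 (horner^~ 0))|j ji].
  by rewrite mxE !eqxx scale1r horner_line scale0r addr0 horner0.
by rewrite mxE (negPf ji) andbF scale0r.
Qed.

(** Affineness is a condition on values, so that the polynomial has first to be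
    identified. *)
Lemma affine_hessian0 p : affine p -> hessian p = 0.
Proof.
move=> [a [b pE]].
have -> : p = \sum_j a 0 j *: 'X_j + mpolyC n b.
  apply: peval_inj => x; rewrite pE /peval mevalD mevalC raddf_sum.
  by congr (_ + _); apply: eq_bigr => j _; rewrite /= mevalZ mevalXU.
apply/matrixP => i j; rewrite !mxE mderivD mderivC addr0.
rewrite (raddf_sum (mderiv j)) (raddf_sum (mderiv i)) big1 // => k _ /=.
by rewrite !mderivZ mderivXU mderivC scaler0.
Qed.

Lemma hessianD p q : hessian (p + q) = hessian p + hessian q.
Proof. by apply/matrixP => i j; rewrite !mxE !mderivD. Qed.

Lemma hessian0_sos_convex p : hessian p = 0 -> sos_convex p.
Proof. by move=> Hp; exists 0%N, 0; rewrite Hp mul0mx. Qed.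

Lemma sos_convexD p q : sos_convex p -> sos_convex q -> sos_convex (p + q).
Proof.
move=> [r [H HE]] [r' [H' HE']]; exists (r + r')%N, (row_mx H H').
by rewrite tr_row_mx mul_row_col hessianD HE HE'.
Qed.

Lemma sos_convexC (c : R) : sos_convex (mpolyC n c).
Proof.
by apply: hessian0_sos_convex; apply/matrixP => i j; rewrite !mxE mderivC mderiv0.
Qed.

Lemma sos_convex_sum (I : Type) (r : seq I) (F : I -> mpoly n R) :
  (forall i, sos_convex (F i)) -> sos_convex (\sum_(i <- r) F i).
Proof.
move=> cvxF; elim/big_ind: _ => //; last exact: sos_convexD.
by rewrite -(mpolyC0 n R); exact: sos_convexC.
Qed.

Lemma sos_convexZ c p : 0 <= c -> sos_convex p -> sos_convex (c *: p).
Proof.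
move=> c_ge0 [r [H HE]]; exists r, (mpolyC n (Num.sqrt c) *: H).
rewrite linearZ /= -scalemxAl -scalemxAr scalerA -mpolyCM -expr2 sqr_sqrtr //.
rewrite -HE; apply/matrixP => i j.
by rewrite !mxE !mderivZ mul_mpolyC.
Qed.

End Vanishing.

(** * Limits along ultrafilters *)

Section UltraLimits.
Context {R : realType} {T : Type} (U : set_system T) {UU : UltraFilter U}.

Lemma ultra_bounded_cvg (u : T -> R) (B : R) :
  (\forall k \near U, `|u k| <= B) -> exists l : R, u @ U --> l.
Proof.
move=> uB; have [|l [_ cl]] := @segment_compact R (- B) B (u @ U) _.
  by apply: filterS uB => k; rewrite /= in_itv /= ler_norml.
exists l => A lA; have [//|UnA] := in_ultra_setVsetC (u @^-1` A) UU.
by have [x [/(_ _)]] := cl (~` A) A UnA lA.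
Qed.

Lemma ultra_bounded_cvg_fun (J : Type) (u : T -> J -> R) (B : R) :
  (\forall k \near U, forall j, `|u k j| <= B) ->
  exists l : J -> R, forall j, u k j @[k --> U] --> l j.
Proof.
move=> uB.
suff /boolp.choice [l ul] : forall j, exists l : R, u k j @[k --> U] --> l by exists l.
by move=> j; apply: (@ultra_bounded_cvg _ B); apply: filterS uB => k; exact.
Qed.

End UltraLimits.

Section PolynomialLimits.
Context {R : realType} {n : nat} {T : Type} (F : set_system T) {FF : Filter F}.

Lemma cvg_peval (p : mpoly n R) (y : T -> 'rV[R]_n) (z : 'rV[R]_n) :
  (forall j, y k 0 j @[k --> F] --> z 0 j) ->
  peval p (y k) @[k --> F] --> peval p z.
Proof.
move=> yz; move: p; apply: mpoly_ring_ind => [c|i|p q IHp IHq|p q IHp IHq].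
- under eq_fun do rewrite /peval mevalC; rewrite /peval mevalC; exact: cvg_cst.
- under eq_fun do rewrite /peval mevalXU; rewrite /peval mevalXU; exact: yz.
- under eq_fun do rewrite /peval mevalD; rewrite /peval mevalD; exact: cvgD.
- under eq_fun do rewrite /peval mevalM; rewrite /peval mevalM; exact: cvgM.
Qed.

Lemma cvg_fsum (J : finType) (u : T -> J -> R) (l : J -> R) :
  (forall j, u k j @[k --> F] --> l j) ->
  \sum_j u k j @[k --> F] --> \sum_j l j.
Proof.
move=> ul; elim: (index_enum J) => [|j s IHs].
  by under eq_fun do rewrite big_nil; rewrite big_nil; exact: cvg_cst.
under eq_fun do rewrite big_cons; rewrite big_cons.
by apply: cvgD => //; exact: ul.
Qed.

End PolynomialLimits.

(** * Attainment of the minimum *)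

Lemma near_minimizer (R : realType) (T : Type) (S : set T) (F : T -> R) (b e : R) :
  S !=set0 -> (forall x, S x -> b <= F x) -> 0 < e ->
  exists y, S y /\ forall z, S z -> F y <= F z + e.
Proof.
move=> [x0 Sx0] Fb e_gt0.
have FS : has_inf (F @` S).
  by split; [exists (F x0), x0|exists b => _ [x Sx <-]; exact: Fb].
have [_ [y Sy <-] Fy] := inf_adherent e_gt0 FS.
exists y; split=> // z Sz; apply/(le_trans (ltW Fy)); rewrite lerD2r.
by apply: ge_inf; [case: FS | exists z].
Qed.

Section Attainment.
Context {R : realType} {n : nat}.
Implicit Types (p : mpoly n R) (x y d : 'rV[R]_n).

Definition dotv x y : R := \sum_j x 0 j * y 0 j.

Lemma coord_le_dotv x (r : R) j : 0 <= r -> dotv x x <= r ^+ 2 -> `|x 0 j| <= r.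
Proof.
move=> r_ge0 xr; rewrite -(@ler_pXn2r _ 2) ?nnegrE // real_normK ?num_real //.
apply: le_trans xr; rewrite /dotv (bigD1 j) //= expr2 lerDl.
by apply: sumr_ge0 => i _; rewrite -expr2 sqr_ge0.
Qed.

Lemma dotvv_ge0 x : 0 <= dotv x x.
Proof. by apply: sumr_ge0 => i _; rewrite -expr2 sqr_ge0. Qed.

Lemma dotvZZ a b x y : dotv (a *: x) (b *: y) = a * b * dotv x y.
Proof. by rewrite mulr_sumr; apply: eq_bigr => j _; rewrite !mxE; ring. Qed.

Lemma dotvZl a x y : dotv (a *: x) y = a * dotv x y.
Proof. by rewrite -[y in LHS]scale1r dotvZZ mulr1. Qed.

Lemma dotv_proj x d :
  dotv d d = 1 ->
  dotv (x - dotv x d *: d) (x - dotv x d *: d) = dotv x x - dotv x d ^+ 2.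
Proof.
move=> d1.
have dotvB s : dotv (x - s *: d) (x - s *: d)
    = dotv x x - 2 * s * dotv x d + s ^+ 2 * dotv d d.
  rewrite /dotv !mulr_sumr -sumrB -big_split.
  by apply: eq_bigr => j _; rewrite !mxE /=; ring.
rewrite dotvB d1; ring.
Qed.

(** On each line of direction [d] the polynomial is bounded on a half-line, hence
    constant.  For a convex function that is not polynomial this fails, as the
    exponential shows. *)
Lemma bounded_below_const_along p x d (b : R) :
  (forall y, b <= peval p y) ->
  (forall y t, 0 <= t -> peval p (y + t *: d) <= peval p y) ->
  forall t, peval p (x + t *: d) = peval p x.
Proof.
move=> pb pd t; rewrite -horner_line.
rewrite (poly_bounded_const (B := `|b| + `|peval p x|)).
  by rewrite horner_line scale0r addr0.
move=> s s_ge0; rewrite horner_line.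
have := pb (x + s *: d); have := pd x s s_ge0.
have := ler_norm (peval p x); have := ler_norm (- b); rewrite normrN.
have := normr_ge0 b; have := normr_ge0 (peval p x).
by move=> *; rewrite ler_norml; apply/andP; split; lra.
Qed.

(** The direction is a limit of [y k] divided by its norm: for fixed [x] and
    [t >= 0], with [s = t / |y k|], the point [(1 - s) x + s (y k)] tends to
    [x + t d], and by convexity the value there exceeds [p x] by at most [s]. *)
Lemma recession_direction (U : set_system nat) (UU : UltraFilter U) p
    (y : nat -> 'rV[R]_n) :
  sos_convex p -> (forall k x, peval p (y k) <= peval p x + 1) ->
  (forall B, \forall k \near U, B < dotv (y k) (y k)) ->
  exists d, [/\ dotv d d = 1,
    forall x t, peval p (x + t *: d) = peval p x
    & \forall k \near U, 1 < dotv (y k) d ^+ 2].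
Proof.
move=> cvxp ymin yoo.
pose r k := Num.sqrt (dotv (y k) (y k)).
have rE k : r k ^+ 2 = dotv (y k) (y k) by rewrite sqr_sqrtr ?dotvv_ge0.
have roo B : \forall k \near U, B < r k.
  apply: filterS (yoo (B ^+ 2)) => k; rewrite -rE => Br.
  have := ler_norm B; have : 0 <= r k by exact: sqrtr_ge0.
  rewrite -(real_normK (num_real B)) in Br.
  by rewrite ltr_pXn2r ?nnegrE ?sqrtr_ge0 // in Br; lra.
have rV0 : (r k)^-1 @[k --> U] --> (0 : R).
  apply/cvgr0Pnorm_le => e e_gt0; apply: filterS (roo e^-1) => k re.
  have rk_gt0 : 0 < r k by apply: lt_trans re; rewrite invr_gt0.
  by rewrite ger0_norm ?invr_ge0 ?ltW // invf_plt ?posrE.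
pose u k := (r k)^-1 *: y k.
have u1 : \forall k \near U, dotv (u k) (u k) = 1.
  apply: filterS (roo 0) => k rk_gt0.
  by rewrite dotvZZ -rE -invfM -expr2 mulVf // expf_neq0 // gt_eqF.
have [|l ul] := ultra_bounded_cvg_fun (u := fun k j => u k 0 j) (B := 1) (U := U).
  by apply: filterS u1 => k uk j; apply: coord_le_dotv; rewrite ?uk ?expr1n.
pose d : 'rV[R]_n := \row_j l j.
have ud j : u k 0 j @[k --> U] --> d 0 j by rewrite mxE; exact: ul.
have d1 : dotv d d = 1.
  have : dotv (u k) (u k) @[k --> U] --> dotv d d.
    by apply: cvg_fsum => j; apply: cvgM; exact: ud.
  move=> /(cvg_unique _); apply => //.
  apply: cvg_near_cst.
  exact: u1.
have decr x t : 0 <= t -> peval p (x + t *: d) <= peval p x.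
  move=> t_ge0; apply/ler_addgt0Pr => e e_gt0.
  pose z k : 'rV[R]_n := (1 - t * (r k)^-1) *: x + (t * (r k)^-1) *: y k.
  have pz : peval p (z k) @[k --> U] --> peval p (x + t *: d).
    apply: cvg_peval => j.
    have -> : (fun k => z k 0 j)
        = (fun k => (1 - t * (r k)^-1) * x 0 j + t * u k 0 j).
      by apply: funext => k; rewrite !mxE; ring.
    have -> : (x + t *: d) 0 j = (1 - t * 0) * x 0 j + t * d 0 j.
      by rewrite !mxE; ring.
    have cst (c : R) : c @[_ --> U] --> c by exact: cvg_cst.
    apply: cvgD; apply: cvgM => //.
    by apply: cvgB => //; apply: cvgM.
  apply: (cvgr_to_le pz).
  have := roo (t / e); apply: filterS2 (roo t) => k rt rte.
  have rk_gt0 : 0 < r k by lra.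
  have s_ge0 : 0 <= t * (r k)^-1 by rewrite mulr_ge0 // invr_ge0 ltW.
  have s_le1 : t * (r k)^-1 <= 1 by rewrite ler_pdivrMr // mul1r ltW.
  have s_lee : t * (r k)^-1 <= e.
    by rewrite ler_pdivrMr // mulrC -ler_pdivrMr // ltW.
  have s'_ge0 : 0 <= 1 - t * (r k)^-1 by lra.
  have := sos_convex_le x (y k) cvxp s'_ge0 s_ge0 (subrK _ _).
  have := ler_wpM2l s_ge0 (ymin k x).
  rewrite -/(z k); lra.
exists d; split=> // [x t|].
  apply: (@bounded_below_const_along _ _ _ (peval p (y 0%N) - 1)) => // z.
  by rewrite lerBlDr; exact: ymin.
have dd : dotv (u k) d @[k --> U] --> dotv d d.
  by apply: cvg_fsum => j; apply: cvgM => //; exact: cvg_cst.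
have : \forall k \near U, 2^-1 < dotv (u k) d.
  by apply: (cvgr_gt _ dd); rewrite d1; lra.
apply: filterS2 (roo 2) => k rk ukd.
have -> : dotv (y k) d = r k * dotv (u k) d.
  rewrite dotvZl mulrA divff ?mul1r // gt_eqF //; lra.
have ru : 1 < r k * dotv (u k) d by nra.
by rewrite expr2; nra.
Qed.

(** Each [y k] is a point of almost minimal norm in a sublevel set whose level
    tends to the infimum.  If the norms stay bounded, a limit point is a
    minimizer.  Otherwise [p] is constant along a recession direction [d], and
    removing from [y k] its component along [d] gives a point of the same
    sublevel set whose squared norm is smaller by more than the tolerance 1. *)
Lemma sos_convex_attains_min p (b : R) :
  sos_convex p -> (forall x, b <= peval p x) ->
  exists y, forall x, peval p y <= peval p x.
Proof.
move=> cvxp pb.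
pose e k : R := k.+1%:R^-1.
have e_gt0 k : 0 < e k by rewrite invr_gt0 ltr0n.
pose level k : set 'rV[R]_n := [set y | forall x, peval p y <= peval p x + e k].
have /boolp.choice [y yP] : forall k, exists y, level k y /\
    forall z, level k z -> dotv y y <= dotv z z + 1.
  move=> k; apply: (@near_minimizer _ _ _ _ 0) => // [|x _]; last exact: dotvv_ge0.
  have [|x _|y [_ yk]] := near_minimizer (S := setT) (F := peval p) (b := b) _ _ (e_gt0 k).
  - by exists 0.
  - exact: pb.
  - by exists y => x; exact: yk.
have [U [UU subU]] := @ultraFilterLemma nat \oo _.
have [[B yB]|yoo] := pselect (exists B, U [set k | dotv (y k) (y k) <= B]).
  (* Both [B] and 1 are needed for [B] to be at most the square of the bound. *)
  have [|l yl] := ultra_bounded_cvg_fun (u := fun k j => y k 0 j)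
    (B := Num.max 1 B) (U := U).
    apply: filterS yB => k /= ykB j.
    have := le_max 1 1 B; have := le_max B 1 B; rewrite !lexx orbT /= => B1 B2.
    apply: coord_le_dotv; first lra.
    by apply: le_trans ykB _; nra.
  exists (\row_j l j) => x.
  have : peval p (y k) @[k --> U] --> peval p (\row_j l j).
    by apply: cvg_peval => j; rewrite mxE; exact: yl.
  move=> pyl; apply/ler_addgt0Pr => s s_gt0; apply: (cvgr_to_le pyl).
  apply: subU; exists (Num.truncn s^-1) => // k /= sk.
  apply: le_trans ((yP k).1 x) _; rewrite lerD2l.
  rewrite /e invf_ple ?posrE ?ltr0n //.
  apply/ltW/(lt_le_trans (truncnS_gt _)); rewrite ler_nat ltnS.
  exact: sk.
have [|B|d [d1 dconst dfar]] := recession_direction UU cvxp (y := y).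
- move=> k x; apply: le_trans ((yP k).1 x) _; rewrite lerD2l.
  by rewrite /e invf_le1 ?ltr0n // ler1n.
- have [UB|] := in_ultra_setVsetC [set k | dotv (y k) (y k) <= B] UU.
    by exfalso; apply: yoo; exists B.
  by apply: filterS => k /negP; rewrite -ltNge.
have [k yk] := filter_ex dfar.
have := (yP k).2 (y k - dotv (y k) d *: d).
rewrite dotv_proj // => /(_ _) h; exfalso.
have : level k (y k - dotv (y k) d *: d).
  by move=> x; rewrite -scaleNr dconst; exact: (yP k).1.
by move/h; lra.
Qed.

(** The gradient [G] at a minimizer vanishes: convexity gives
    [dirder p (y - s G) G <= 0] for [s > 0], and the limit as [s] tends to 0 is
    [|G| ^ 2 <= 0]. *)
Lemma minimizer_tangent p y :
  sos_convex p -> (forall x, peval p y <= peval p x) ->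
  tangent p y = mpolyC n (peval p y).
Proof.
move=> cvxp ymin.
pose G : 'rV[R]_n := \row_j peval (mderiv j p) y.
have dirG_le0 s : 0 < s -> dirder p (y - s *: G) G <= 0.
  move=> s_gt0; have := sos_convex_tangent_le (y - s *: G) y cvxp.
  rewrite subKr dirderZ => le_y.
  by rewrite -(pmulr_rle0 _ s_gt0); have := ymin (y - s *: G); lra.
have dirG : dirder p (y - s *: G) G @[s --> 0^'+] --> dirder p y G.
  apply: cvg_fsum => j; apply: cvgM; last exact: cvg_cst.
  apply: cvg_peval => i.
  have -> : (fun s => (y - s *: G) 0 i) = (fun s => y 0 i - s * G 0 i).
    by apply: funext => s; rewrite !mxE.
  suff : y 0 i - s * G 0 i @[s --> 0^'+] --> y 0 i - 0 * G 0 i.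
    by rewrite mul0r subr0.
  apply: cvgB; first exact: cvg_cst.
  apply: cvgM; last exact: cvg_cst.
  exact/cvg_at_right_filter/cvg_id.
have G_le0 : dirder p y G <= 0.
  by apply: (cvgr_to_le dirG); near=> s; apply: dirG_le0; near: s; exact: nbhs_right_gt.
have G0 j : peval (mderiv j p) y = 0.
  apply/eqP; rewrite -sqrf_eq0 eq_le sqr_ge0 andbT; apply: le_trans G_le0.
  rewrite /dirder (bigD1 j) //= mxE -expr2 lerDl.
  by apply: sumr_ge0 => i _; rewrite mxE -expr2 sqr_ge0.
by rewrite /tangent big1 ?addr0 // => j _; rewrite G0 scale0r.
Unshelve. all: end_near.
Qed.

Theorem sos_convex_ge0_is_sos p :
  sos_convex p -> (forall x, 0 <= peval p x) -> is_sos p.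
Proof.
move=> cvxp p_ge0; have [y ymin] := sos_convex_attains_min cvxp p_ge0.
have := is_sos_sub_tangent y cvxp; rewrite minimizer_tangent // => sosp.
by rewrite -(subrK (mpolyC n (peval p y)) p); apply: is_sosD => //; exact: is_sosC.
Qed.

End Attainment.

(** * Separation of a convex cone from the origin *)

Lemma small_perturbation (R : realType) (T : eqType) (s : seq T) (u v : T -> R) :
  {in s, forall a, 0 < u a} ->
  exists2 e, 0 < e & {in s, forall a, 0 < u a + e * v a}.
Proof.
move=> u_gt0.
suff [e0 e0_gt0 e0P] : exists2 e0, 0 < e0 &
    forall e, 0 < e -> e <= e0 -> {in s, forall a, 0 < u a + e * v a}.
  by exists e0 => //; exact: e0P.
elim: s u_gt0 => [|a s IHs] u_gt0; first by exists 1.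
have [b bs|e0 e0_gt0 e0P] := IHs; first by apply: u_gt0; rewrite inE bs orbT.
have ua_gt0 : 0 < u a by apply: u_gt0; rewrite mem_head.
have v1_gt0 : 0 < `|v a| + 1 by rewrite ltr_wpDl.
exists (Num.min e0 (u a / (`|v a| + 1))).
  by rewrite lt_min e0_gt0 divr_gt0.
move=> e e_gt0; rewrite le_min => /andP[ee0 eu] b; rewrite inE => /predU1P[->|bs].
  have ev : e * (`|v a| + 1) <= u a by rewrite -ler_pdivlMr.
  have := ler_norm (- v a); rewrite normrN => va.
  have : e * - v a <= e * `|v a| by rewrite ler_wpM2l // ltW.
  by rewrite mulrN; lra.
exact: e0P.
Qed.

Section Separation.
Context {R : realType} {J : finType}.
Implicit Types (w a b : {ffun J -> R}).

Definition pairing w a : R := \sum_j w j * a j.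

Lemma pairingDl w w' a : pairing (w + w') a = pairing w a + pairing w' a.
Proof. by rewrite -big_split; apply: eq_bigr => j _; rewrite !ffunE mulrDl. Qed.

Lemma pairingZl s w a : pairing (s *: w) a = s * pairing w a.
Proof. by rewrite mulr_sumr; apply: eq_bigr => j _; rewrite !ffunE -mulrA. Qed.

Lemma pairingDr w a b : pairing w (a + b) = pairing w a + pairing w b.
Proof. by rewrite -big_split; apply: eq_bigr => j _; rewrite !ffunE mulrDr. Qed.

Lemma pairingZr s w a : pairing w (s *: a) = s * pairing w a.
Proof. by rewrite mulr_sumr; apply: eq_bigr => j _; rewrite !ffunE mulrCA. Qed.

Variable A : set {ffun J -> R}.
Hypothesis A_add : forall a b, A a -> A b -> A (a + b).
Hypothesis A_scale : forall s a, 0 < s -> A a -> A (s *: a).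
Hypothesis A_neq0 : forall a, A a -> 0 < pairing a a.

(** Gordan's alternative, by elimination: if [w] is positive on all vectors but
    [b], where it is negative, replace each other vector [a] by the combination
    of [a] and [b] on which [w] vanishes; a solution for these vectors is
    corrected by a multiple of [w] into a solution for the original ones. *)
Lemma gordan_finite (F : seq {ffun J -> R}) :
  {in F, forall a, A a} -> exists w, {in F, forall a, 0 < pairing w a}.
Proof.
have [k] := ubnP (size F); elim: k F => // k IHk [|b F] /= sF AF.
  by exists 0.
have AF' : {in F, forall a, A a} by move=> a aF; apply: AF; rewrite inE aF orbT.
have Ab : A b by apply: AF; rewrite mem_head.
have [w wF] := IHk F sF AF'.
have [wb_gt0|wb_lt0|wb0] := ltrgt0P (pairing w b).
- by exists w => a; rewrite inE => /predU1P[->//|]; exact: wF.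
- pose lift a := pairing w a *: b + (- pairing w b) *: a.
  have [||w' w'F] := IHk [seq lift a | a <- F]; first by rewrite size_map.
    move=> _ /mapP[a aF ->]; apply: A_add; apply: A_scale => //.
    - exact: wF.
    - by rewrite oppr_gt0.
    - exact: AF'.
  have w'l : {in F, forall a, 0 < pairing w' (lift a) / - pairing w b}.
    by move=> a aF; rewrite divr_gt0 ?oppr_gt0 // w'F // map_f.
  have [e e_gt0 eP] := small_perturbation (fun a => - pairing w a) w'l.
  (* The multiple that cancels the value at [b], minus [e] to make it positive. *)
  exists (w' + (pairing w' b / - pairing w b - e) *: w) => a.
  rewrite pairingDl pairingZl inE => /predU1P[->|aF].
    rewrite (_ : _ + _ = e * - pairing w b); first by rewrite mulr_gt0 ?oppr_gt0.
    by field; rewrite lt_eqF.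
  have := eP a aF; rewrite /= pairingDr !pairingZr.
  by congr (0 < _); field; rewrite lt_eqF.
- have [e e_gt0 eP] := small_perturbation (pairing b) wF.
  exists (w + e *: b) => a; rewrite pairingDl pairingZl inE => /predU1P[->|aF].
    by rewrite wb0 add0r mulr_gt0 // A_neq0.
  exact: eP.
Qed.

Lemma unit_gordan_finite (a0 : {ffun J -> R}) (F : seq {ffun J -> R}) :
  A a0 -> {in F, forall a, A a} ->
  exists w, pairing w w = 1 /\ {in F, forall a, 0 <= pairing w a}.
Proof.
move=> Aa0 AF; have [|w wF] := @gordan_finite (a0 :: F).
  by move=> a; rewrite inE => /predU1P[->//|]; exact: AF.
have ww_gt0 : 0 < pairing w w.
  rewrite lt_def sumr_ge0 ?andbT => [|j _]; last by rewrite -expr2 sqr_ge0.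
  apply/eqP => ww0; have := wF a0 (mem_head _ _).
  rewrite /pairing big1 ?ltxx // => j _.
  rewrite (@sum_sqr_le0 _ _ predT w) ?mul0r //.
  by move: ww0; rewrite /pairing; under eq_bigr do rewrite -expr2; move=> ->.
pose r := Num.sqrt (pairing w w).
have r_gt0 : 0 < r by rewrite sqrtr_gt0.
exists (r^-1 *: w); split.
  rewrite pairingZl pairingZr mulrA -invfM -expr2 sqr_sqrtr ?ltW //.
  by rewrite mulVf // gt_eqF.
move=> a aF; rewrite pairingZl mulr_ge0 ?invr_ge0 ?ltW //.
by apply: wF; rewrite inE aF orbT.
Qed.

(** Unit vectors [w F] that are nonnegative on finite subsets [F] of the cone
    converge along an ultrafilter for which every element of the cone
    eventually belongs to [F].  The normalization keeps the limit nonzero. *)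
Theorem cone_separation :
  A !=set0 -> exists2 w, w != 0 & forall a, A a -> 0 <= pairing w a.
Proof.
move=> [a0 Aa0].
pose inA (F : seq {ffun J -> R}) := {in F, forall a, A a}.
pose G : set_system (seq {ffun J -> R}) := [set S : set (seq {ffun J -> R}) |
  exists2 F0, inA F0 & forall F : seq {ffun J -> R}, {subset F0 <= F} -> inA F -> S F].
have GG : ProperFilter G.
  apply: Build_ProperFilter_ex => [S [F0 F0A F0S]|].
    by exists F0; exact: F0S.
  split.
  - by exists [::].
  - move=> S S' [F AF FS] [F' AF' FS']; exists (F ++ F').
      by move=> a; rewrite mem_cat => /orP[/AF|/AF'].
    move=> E FE AE; split; [apply: FS|apply: FS'] => // a aF;
      by apply: FE; rewrite mem_cat aF ?orbT.
  - by move=> S S' SS' [F AF FS]; exists F => // E FE AE; apply/SS'/FS.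
have [U [UU subU]] := ultraFilterLemma GG.
have /boolp.choice [w wP] : forall F, exists w, inA F ->
    pairing w w = 1 /\ {in F, forall a, 0 <= pairing w a}.
  move=> F; have [AF|nAF] := pselect (inA F); last by exists 0.
  by have [w wP] := unit_gordan_finite Aa0 AF; exists w.
have w1 : \forall F \near U, pairing (w F) (w F) = 1.
  by apply: subU; exists [::] => // F _ /wP[].
have [|l wl] := ultra_bounded_cvg_fun (u := fun F j => w F j) (B := 1) (U := U).
  apply: filterS w1 => F wF1 j.
  rewrite -(@ler_pXn2r _ 2) ?nnegrE // real_normK ?num_real // expr1n -wF1.
  rewrite /pairing (bigD1 j) //= expr2 lerDl.
  by apply: sumr_ge0 => i _; rewrite -expr2 sqr_ge0.
have wl' a : pairing (w F) a @[F --> U] --> pairing [ffun j => l j] a.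
  apply: cvg_fsum => j; apply: cvgM; last exact: cvg_cst.
  by rewrite ffunE; exact: wl.
exists [ffun j => l j] => [|a Aa].
  apply/eqP => l0.
  have : pairing (w F) (w F) @[F --> U] --> \sum_j l j * l j.
    by apply: cvg_fsum => j; apply: cvgM; exact: wl.
  have -> : \sum_j l j * l j = 0.
    apply: big1 => j _; have := congr1 (fun h : {ffun J -> R} => h j) l0.
    by rewrite !ffunE => ->; rewrite mul0r.
  have : pairing (w F) (w F) @[F --> U] --> (1 : R) by exact: cvg_near_cst.
  move=> /(cvg_unique _) h /h => /(_ (@Rhausdorff R))/eqP.
  by rewrite oner_eq0.
apply: (cvgr_to_ge (wl' a)); apply: subU; exists [:: a].
  by move=> b; rewrite inE => /eqP ->.
by move=> F aF /wP[_]; apply; apply: aF; rewrite mem_head.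
Qed.

End Separation.

(** * The cone of weights dual to the uncertainty set *)

Section DualCone.
Context {R : realType} (t q : nat).
Implicit Types (v : 'rV[R]_q) (w : 'rV[R]_q.+1) (b : 'I_q.+1 -> R).

Definition homog v b : R := b ord0 + \sum_(r < q) v 0 r * b (lift ord0 r).

Definition worst_le0 : set ('I_q.+1 -> R) :=
  [set b | forall v, Vhat t v -> homog v b <= 0].

Definition dual_cone : set 'rV[R]_q.+1 :=
  [set w | [/\ norm_on (fun r : 'I_q.+1 => (0 < r <= t)%N) w <= w 0 ord0,
    norm_on (fun r : 'I_q.+1 => (t < r)%N) w <= w 0 ord0
    & forall r : 'I_q.+1, (r <= t)%N -> 0 <= w 0 r]].

Lemma norm_on_le (N : nat) (P : pred 'I_N) (u : 'rV[R]_N) (c : R) :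
  0 <= c -> (norm_on P u <= c) = (\sum_(r | P r) u 0 r ^+ 2 <= c ^+ 2).
Proof.
move=> c_ge0; rewrite -(@ler_pXn2r _ 2) ?nnegrE ?sqrtr_ge0 // sqr_sqrtr //.
by apply: sumr_ge0 => r _; exact: sqr_ge0.
Qed.

(** [dual_cone] is the cone over the points [(1, v)]: a nonzero weight has a
    positive first entry, since that entry bounds the norms of the others. *)
Lemma dual_cone_ray w : dual_cone w ->
  w = 0 \/ 0 < w 0 ord0 /\ exists2 v, Vhat t v &
    forall b, \sum_r w 0 r * b r = w 0 ord0 * homog v b.
Proof.
move=> [w1 w2 w_ge0]; have := w_ge0 ord0 (leq0n _).
rewrite le_eqVlt => /predU1P[w0|w0_gt0].
  left; rewrite -w0 !norm_on_le // !expr0n /= in w1 w2.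
  apply/rowP => r; rewrite mxE; have [r0|r_gt0] := posnP r.
    by rewrite w0; congr (w 0 _); exact: val_inj.
  have [rt|tr] := leqP r t; first by apply: (sum_sqr_le0 w1); rewrite r_gt0 rt.
  exact: (sum_sqr_le0 w2).
right; split=> //; pose v : 'rV[R]_q := \row_r (w 0 (lift ord0 r) / w 0 ord0).
have norm_v (P : pred nat) : ~~ P 0%N ->
    norm_on (fun r : 'I_q.+1 => P r) w <= w 0 ord0 ->
    norm_on (fun r : 'I_q => P r.+1) v <= 1.
  move=> P0; rewrite !norm_on_le ?ler01 ?(ltW w0_gt0) //.
  rewrite big_mkcond big_ord_recl /= (negPf P0) add0r.
  rewrite -big_mkcond /= => le_w.
  under eq_bigr => r _ do rewrite mxE expr_div_n.
  by rewrite -mulr_suml expr1n ler_pdivrMr ?exprn_gt0 // mul1r.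
exists v; first split.
- by move=> r rt; rewrite mxE divr_ge0 ?w_ge0 // ?ltW // lift0.
- exact: (norm_v (fun r => 0 < r <= t)%N).
- exact: (norm_v (fun r => t < r)%N).
move=> b; rewrite /homog mulrDr big_ord_recl; congr (_ + _).
rewrite mulr_sumr; apply: eq_bigr => r _.
by rewrite mxE mulrA mulrCA mulfV ?mulr1 // gt_eqF.
Qed.

Lemma sum_mul_le (P : pred 'I_q) (u v : 'I_q -> R) (N : R) :
  0 <= N -> \sum_(r | P r) u r ^+ 2 <= N ^+ 2 -> \sum_(r | P r) v r ^+ 2 <= 1 ->
  \sum_(r | P r) v r * u r <= N.
Proof.
rewrite le_eqVlt => /predU1P[<- |N_gt0] uN v1.
  rewrite big1 // => r Pr; rewrite (sum_sqr_le0 (u := u) _ Pr) ?mulr0 //.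
  by rewrite expr0n in uN.
have : \sum_(r | P r) 2 * N * (v r * u r) <=
    \sum_(r | P r) (N ^+ 2 * v r ^+ 2 + u r ^+ 2).
  by apply: ler_sum => r _; have := sqr_ge0 (N * v r - u r); lra.
rewrite -mulr_sumr big_split /= -mulr_sumr => le_sum.
have : N ^+ 2 * \sum_(r | P r) v r ^+ 2 <= N ^+ 2 by rewrite ler_piMr // sqr_ge0.
move=> le_v; rewrite -(@ler_pM2l _ (2 * N)); last lra.
by apply: le_trans le_sum _; lra.
Qed.

(** Signs are obtained by testing against the opposites of basis vectors.  For the
    norm over an index block [P], of value [N], the test vector is [- N] at 0
    and [w] on [P], which satisfies the robust constraint by Cauchy-Schwarz. *)
Lemma dual_coneP w :
  (forall b, worst_le0 b -> \sum_r w 0 r * b r <= 0) -> dual_cone w.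
Proof.
move=> wb.
have w_ge0 (r : 'I_q.+1) : (r <= t)%N -> 0 <= w 0 r.
  move=> rt; have := wb (fun i => - (i == r)%:R) _.
  rewrite (bigD1 r) //= eqxx big1 ?addr0 => [|i /negPf ->]; last by rewrite oppr0 mulr0.
  rewrite mulrN1 oppr_le0; apply=> v [v_ge0 _ _]; rewrite /homog.
  rewrite -lerBrDl opprK; apply: (@le_trans _ _ 0); last by case: eqP.
  rewrite sumr_le0 // => i _; rewrite mulrN oppr_le0; case: eqVneq => [ir|_].
    by rewrite mulr1 v_ge0 // -(lift0 i) ir.
  by rewrite mulr0.
have norm_le (P : pred nat) : ~~ P 0%N ->
    (forall v, Vhat t v -> norm_on (fun r : 'I_q => P r.+1) v <= 1) ->
    norm_on (fun r : 'I_q.+1 => P r) w <= w 0 ord0.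
  move=> P0 vP; set N := norm_on _ w.
  have N_ge0 : 0 <= N by exact: sqrtr_ge0.
  have NE : N ^+ 2 = \sum_(r < q | P r.+1) w 0 (lift ord0 r) ^+ 2.
    rewrite sqr_sqrtr ?sumr_ge0 // => [|r _]; last exact: sqr_ge0.
    by rewrite big_mkcond big_ord_recl /= (negPf P0) add0r -big_mkcond.
  pose b (r : 'I_q.+1) := if r == ord0 then - N else if P r then w 0 r else 0.
  have sumE (u : 'I_q -> R) : \sum_r u r * b (lift ord0 r)
      = \sum_(r < q | P r.+1) u r * w 0 (lift ord0 r).
    rewrite [RHS]big_mkcond; apply: eq_bigr => r _.
    by rewrite /b -val_eqE lift0 /=; case: ifP => _ //; rewrite mulr0.
  have b0 : b ord0 = - N by rewrite /b eqxx.
  have : w 0 ord0 * - N + N ^+ 2 <= 0.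
    rewrite NE; under eq_bigr do rewrite expr2.
    rewrite -(sumE (fun r => w 0 (lift ord0 r))) -b0.
    have := wb b; rewrite big_ord_recl; apply => v Vv.
    rewrite /homog b0 sumE addrC subr_le0.
    apply: sum_mul_le; rewrite ?NE //.
    by have := vP v Vv; rewrite norm_on_le // expr1n.
  have := w_ge0 ord0 (leq0n _); move: N_ge0; rewrite le_eqVlt => /predU1P[<- //|N_gt0] _.
  by rewrite mulrN addrC subr_le0 expr2 ler_pM2r.
split=> //.
- by apply: (norm_le (fun r => 0 < r <= t)%N) => // v [].
- by apply: (norm_le (fun r => t < r)%N) => // v [].
Qed.

Lemma dual_cone_pairing_le0 w b :
  dual_cone w -> worst_le0 b -> \sum_r w 0 r * b r <= 0.
Proof.
move=> /dual_cone_ray[->|[w0 [v Vv ->]]] bP.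
  by rewrite big1 // => r _; rewrite mxE mul0r.
by rewrite pmulr_rle0 //; exact: bP.
Qed.

Lemma dual_coneZ (a : R) w : 0 <= a -> dual_cone w -> dual_cone (a *: w).
Proof.
move=> a_ge0 wP; apply: dual_coneP => b bP.
under eq_bigr do rewrite mxE -mulrA.
by rewrite -mulr_sumr mulr_ge0_le0 // dual_cone_pairing_le0.
Qed.

End DualCone.

(** * Lagrangian duality *)

Lemma slope_ge0 (R : realType) (a b : R) :
  (forall s, 0 <= s -> 0 <= a + s * b) -> 0 <= b.
Proof.
move=> ab; rewrite leNgt; apply/negP => b_lt0.
have s_ge0 : 0 <= (`|a| + 1) / - b by rewrite divr_ge0 // ?addr_ge0 // oppr_ge0 ltW.
have := ab _ s_ge0.
have -> : (`|a| + 1) / - b * b = - (`|a| + 1) by field; rewrite lt_eqF.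
by have := ler_norm a; lra.
Qed.

Lemma intercept_ge0 (R : realType) (a b : R) :
  (forall s, 0 < s -> 0 <= a + s * b) -> 0 <= a.
Proof.
move=> ab; rewrite leNgt; apply/negP => a_lt0.
have b1_gt0 : 0 < `|b| + 1 by rewrite ltr_wpDl.
have s_gt0 : 0 < - a / 2 / (`|b| + 1) by rewrite !divr_gt0 // oppr_gt0.
have := ab _ s_gt0.
have : - a / 2 / (`|b| + 1) * b <= - a / 2.
  rewrite mulrAC ler_pdivrMr // ler_wpM2l //; first lra.
  by have := ler_norm b; lra.
lra.
Qed.

Lemma affine_convex_comb (R : realType) (n : nat) (p : mpoly n R)
    (x y : 'rV[R]_n) (a b : R) :
  affine p -> a + b = 1 -> peval p (a *: x + b *: y) = a * peval p x + b * peval p y.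
Proof.
move=> [c [e pE]] ab1; rewrite !pE !mulrDr addrACA -[a * e + b * e]mulrDl ab1 mul1r.
congr (_ + _); rewrite !mulr_sumr -big_split.
by apply: eq_bigr => j _; rewrite !mxE /=; ring.
Qed.

(** Convexity in the homogenized form needed for sums of points of [epi_cone]. *)
Lemma sos_convex_perspective (R : realType) (n : nat) (p : mpoly n R)
    (x y : 'rV[R]_n) (a b : R) : sos_convex p -> 0 < a -> 0 < b ->
  (a + b) * peval p ((a / (a + b)) *: x + (b / (a + b)) *: y)
    <= a * peval p x + b * peval p y.
Proof.
move=> cvxp a_gt0 b_gt0; have ab_gt0 : 0 < a + b by rewrite addr_gt0.
rewrite mulrC -ler_pdivlMr // mulrDl !(mulrAC _ _ (a + b)^-1).
apply: sos_convex_le; rewrite ?divr_ge0 ?ltW //.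
by rewrite -mulrDl mulfV // gt_eqF.
Qed.

Section Duality.
Context {R : realType} {n m : nat}.
Variables (f : mpoly n R) (t q : 'I_m -> nat).
Variable g : forall i : 'I_m, 'I_(q i).+1 -> mpoly n R.
Hypothesis f_cvx : sos_convex f.
Hypothesis g_cvx : forall i (r : 'I_(q i).+1), (r <= t i)%N -> sos_convex (g r).
Hypothesis g_aff : forall i (r : 'I_(q i).+1), (t i < r)%N -> affine (g r).

Local Notation gval x i := (fun r : 'I_(q i).+1 => peval (@g i r) x).

Definition lagrangian (w : forall i, 'rV[R]_(q i).+1) : mpoly n R :=
  f + \sum_(i < m) \sum_(r < (q i).+1) w i 0 r *: g r.

Lemma peval_lagrangian w x : peval (lagrangian w) x
  = peval f x + \sum_i \sum_r w i 0 r * peval (@g i r) x.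
Proof.
rewrite /lagrangian {1}/peval mevalD raddf_sum; congr (_ + _).
apply: eq_bigr => i _ /=; rewrite raddf_sum; apply: eq_bigr => r _ /=.
by rewrite mevalZ.
Qed.

Lemma sos_convex_lagrangian w :
  (forall i, dual_cone (t i) (w i)) -> sos_convex (lagrangian w).
Proof.
move=> wP; apply: sos_convexD => //; apply: sos_convex_sum => i.
apply: sos_convex_sum => r; have [_ _ w_ge0] := wP i.
have [rt|tr] := leqP r (t i); first by apply: sos_convexZ; [exact: w_ge0|exact: g_cvx].
have [c [e gE]] := g_aff tr.
apply/hessian0_sos_convex/affine_hessian0.
exists (w i 0 r *: c), (w i 0 r * e) => x.
rewrite /peval mevalZ -/(peval _ _) gE mulrDr mulr_sumr; congr (_ + _).
by apply: eq_bigr => j _; rewrite mxE mulrA.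
Qed.

Local Notation index := (unit + {i : 'I_m & 'I_(q i).+1})%type.

Definition block (z : {ffun index -> R}) (i : 'I_m) (r : 'I_(q i).+1) : R :=
  z (inr (Tagged (fun i => 'I_(q i).+1) r)).

Definition of_blocks (z0 : R) (b : forall i, 'I_(q i).+1 -> R) : {ffun index -> R} :=
  [ffun j => match j with inl _ => z0 | inr u => b (tag u) (tagged u) end].

Lemma pairing_blocks (w z : {ffun index -> R}) : pairing w z
  = w (inl tt) * z (inl tt) + \sum_i \sum_r block w r * @block z i r.
Proof.
rewrite /pairing big_sumType /=; congr (_ + _).
  by rewrite (big_pred1 tt) // => -[].
by rewrite [RHS]sig_big_dep; apply: eq_bigr => -[i r] _.
Qed.

(** The conic hull of the set of points above a vector of values of [f - c] and
    of the constraints, strictly in the first entry, and in the others for the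
    order whose negative cone is [worst_le0].  Taking the hull from the start makes separation from the origin a
    statement about cones. *)
Definition epi_cone (c : R) : set {ffun index -> R} :=
  [set z : {ffun index -> R} | exists (s : R) x,
    [/\ 0 < s, s * (peval f x - c) < z (inl tt)
    & forall i, worst_le0 (t i) (fun r => s * peval (@g i r) x - block z r)]].

(** The components of index above [t i] enter with weights of arbitrary sign, which
    is harmless since they are affine and so combine with equality. *)
Lemma worst_le0_combine (i : 'I_m) (x1 x2 : 'rV[R]_n) (s1 s2 : R)
    (z1 z2 : 'I_(q i).+1 -> R) : 0 < s1 -> 0 < s2 ->
  worst_le0 (t i) (fun r => s1 * peval (g r) x1 - z1 r) ->
  worst_le0 (t i) (fun r => s2 * peval (g r) x2 - z2 r) ->
  worst_le0 (t i) (fun r => (s1 + s2) *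
    peval (g r) ((s1 / (s1 + s2)) *: x1 + (s2 / (s1 + s2)) *: x2) - (z1 r + z2 r)).
Proof.
move=> s1_gt0 s2_gt0 le1 le2 v Vv; have s_gt0 : 0 < s1 + s2 by rewrite addr_gt0.
have [v_ge0 _ _] := Vv; have := lerD (le1 v Vv) (le2 v Vv); rewrite addr0.
apply: le_trans; rewrite /homog addrACA -big_split /=.
have cvx (r : 'I_(q i).+1) (rt : (r <= t i)%N) :=
  sos_convex_perspective x1 x2 (g_cvx rt) s1_gt0 s2_gt0.
apply: lerD; first by have := cvx ord0 (leq0n _); lra.
apply: ler_sum => r _; rewrite -mulrDr.
have [rt|tr] := ltnP r (t i).
  apply: ler_wpM2l; first exact: v_ge0.
  by have := cvx (lift ord0 r); rewrite lift0 => /(_ rt); lra.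
have := g_aff (r := lift ord0 r); rewrite lift0 => /(_ tr) aff.
rewrite affine_convex_comb // -?mulrDl ?mulfV ?gt_eqF //.
rewrite le_eqVlt; apply/orP; left; apply/eqP.
by field; rewrite gt_eqF.
Qed.

Lemma epi_cone_add c z1 z2 :
  epi_cone c z1 -> epi_cone c z2 -> epi_cone c (z1 + z2).
Proof.
move=> [s1 [x1 [s1_gt0 f1 g1]]] [s2 [x2 [s2_gt0 f2 g2]]].
have s_gt0 : 0 < s1 + s2 by rewrite addr_gt0.
exists (s1 + s2), ((s1 / (s1 + s2)) *: x1 + (s2 / (s1 + s2)) *: x2); split=> //.
  rewrite ffunE; apply: le_lt_trans (ltrD f1 f2).
  by have := sos_convex_perspective x1 x2 f_cvx s1_gt0 s2_gt0; lra.
move=> i; under eq_fun do rewrite /block ffunE.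
exact: worst_le0_combine.
Qed.

Lemma epi_cone_scale c (s : R) z : 0 < s -> epi_cone c z -> epi_cone c (s *: z).
Proof.
move=> s_gt0 [s' [x [s'_gt0 fz gz]]]; exists (s * s'), x; split.
- exact: mulr_gt0.
- by rewrite ffunE -mulrA ltr_pM2l.
have scaleE j : (s *: z) j = s * z j by rewrite ffunE.
move=> i v Vv; have := gz i v Vv; rewrite -(pmulr_rle0 _ s_gt0).
congr (_ <= 0); rewrite /homog mulrDr /block; congr (_ + _).
  by rewrite scaleE; ring.
by rewrite mulr_sumr; apply: eq_bigr => r _; rewrite scaleE; ring.
Qed.

Lemma homog_uncertain i (v : 'rV[R]_(q i)) x :
  homog v (gval x i) = uncertain (@g i) v x.
Proof. by []. Qed.

(** The point 0 is outside the cone because a point of the cone at 0 would be a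
    feasible [x] with [peval f x < c].  A separating functional [W] is
    evaluated on the points over [x] with objective slack [e] and constraint
    slack [b]: a large [e] gives the sign of [w0], a large [b] gives the
    membership in [dual_cone], and small slacks give the inequality for the
    Lagrangian. *)
Theorem lagrange_multipliers c :
  primal_strictly_feasible t g !=set0 ->
  (forall x, primal_feasible t g x -> c <= peval f x) ->
  exists w, (forall i, dual_cone (t i) (w i)) /\
    forall x, c <= peval (lagrangian w) x.
Proof.
move=> [xs xs_slater] c_le.
have cone_neq0 z : epi_cone c z -> 0 < pairing z z.
  move=> [s [x [s_gt0 fz gz]]]; rewrite lt_def sumr_ge0 ?andbT => [|j _]; last first.
    by rewrite -expr2 sqr_ge0.
  apply/eqP => zz0; have z0 j : z j = 0.
    move: zz0; rewrite /pairing; under eq_bigr do rewrite -expr2.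
    by move=> zz0; apply: (@sum_sqr_le0 _ _ predT) => //; rewrite zz0.
  have : peval f x < c.
    by move: fz; rewrite z0 pmulr_rlt0 // subr_lt0.
  rewrite ltNge => /negP; apply; apply: c_le => i v Vv.
  have := gz i v Vv; rewrite -homog_uncertain /homog /block.
  under eq_bigr do rewrite z0 subr0 mulrCA.
  by rewrite z0 subr0 -mulr_sumr -mulrDr pmulr_rle0.
have epi_point x (e : R) b : 0 < e -> (forall i, worst_le0 (t i) (b i)) ->
    epi_cone c (of_blocks (peval f x - c + e)
      (fun i r => peval (@g i r) x - b i r)).
  move=> e_gt0 bP; exists 1, x; split=> //.
    by rewrite ffunE mul1r ltrDl.
  move=> i; have -> : (fun r : 'I_(q i).+1 => 1 * peval (g r) x
      - block (of_blocks (peval f x - c + e)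
                 (fun i r => peval (@g i r) x - b i r)) r) = b i; last exact: bP.
  by apply: funext => r; rewrite /block ffunE /= mul1r subKr.
pose zero i : 'I_(q i).+1 -> R := fun=> 0.
have zeroP i : worst_le0 (t i) (@zero i).
  by move=> v _; rewrite /homog big1 ?addr0 // => r _; rewrite mulr0.
have [|W W_neq0 W_ge0] :=
  cone_separation (@epi_cone_add c) (@epi_cone_scale c) cone_neq0.
  by eexists; exact: (epi_point xs 1 zero ltr01 zeroP).
pose w0 := W (inl tt).
pose w i : 'rV[R]_(q i).+1 := \row_r block W r.
pose wg x := \sum_i \sum_r w i 0 r * peval (@g i r) x.
have W_point x (e : R) b : 0 < e -> (forall i, worst_le0 (t i) (b i)) ->
    0 <= w0 * (peval f x - c + e) + wg x - \sum_i \sum_r w i 0 r * b i r.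
  move=> e_gt0 bP; have := W_ge0 _ (epi_point x e b e_gt0 bP).
  rewrite pairing_blocks ffunE /wg -[w0 * _ + _ - _]addrA -sumrB.
  congr (_ <= _ + _); apply: eq_bigr => i _.
  rewrite -sumrB; apply: eq_bigr => r _.
  by rewrite mxE [X in _ * X]/block ffunE mulrBr.
have sum_zero : \sum_i \sum_r w i 0 r * @zero i r = 0.
  by rewrite big1 // => i _; rewrite big1 // => r _; rewrite mulr0.
have w0_ge0 : 0 <= w0.
  apply: (@slope_ge0 _ (w0 * (peval f xs - c + 1) + wg xs)) => s s_ge0.
  have s1_gt0 : 0 < 1 + s by lra.
  by have := W_point xs _ _ s1_gt0 zeroP; rewrite sum_zero; lra.
have w_cone i : dual_cone (t i) (w i).
  apply: dual_coneP => b bP; rewrite -oppr_ge0.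
  apply: (@slope_ge0 _ (w0 * (peval f xs - c + 1) + wg xs)) => s s_ge0.
  pose sb : forall j, 'I_(q j).+1 -> R := dfwith zero (fun r => s * b r).
  have sbP j : worst_le0 (t j) (sb j).
    rewrite /sb; case: dfwithP => // v Vv.
    rewrite /homog; under eq_bigr do rewrite mulrCA.
    by rewrite -mulr_sumr -mulrDr mulr_ge0_le0 //; exact: bP.
  have sum_sb : \sum_j \sum_r w j 0 r * sb j r = s * \sum_r w i 0 r * b r.
    rewrite (bigD1 i) //= [X in _ + X]big1 ?addr0 => [|j ji]; last first.
      by rewrite /sb dfwith_out 1?eq_sym // big1 // => r _; rewrite mulr0.
    by rewrite /sb dfwith_in mulr_sumr; apply: eq_bigr => r _; rewrite mulrCA.
  by have := W_point xs _ _ ltr01 sbP; rewrite sum_sb; lra.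
have w_lagr x : 0 <= w0 * (peval f x - c) + wg x.
  apply: (@intercept_ge0 _ _ w0) => e e_gt0.
  by have := W_point x _ _ e_gt0 zeroP; rewrite sum_zero; lra.
(* If [w0] were 0, the Slater point would make every nonzero block of [W]
   contribute a negative amount. *)
have w0_gt0 : 0 < w0.
  rewrite lt_def w0_ge0 andbT; apply: contra_neq W_neq0 => w00.
  have term i : w i = 0 \/ \sum_r w i 0 r * peval (@g i r) xs < 0.
    have [->|[wi0 [v Vv ->]]] := dual_cone_ray (w_cone i); [by left|right].
    by rewrite pmulr_rlt0 // homog_uncertain; exact: xs_slater.
  have wi0 i : w i = 0.
    have [//|lt0] := term i; exfalso.
    have := w_lagr xs; rewrite w00 mul0r add0r /wg (bigD1 i) //= leNgt => /negP; apply.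
    rewrite ltr_nwDl // sumr_le0 // => j _.
    have [->|/ltW //] := term j.
    by rewrite big1 // => r _; rewrite mxE mul0r.
  apply/ffunP => -[[]|[i r]]; rewrite [RHS]ffunE; first exact: w00.
  by have := congr1 (fun u : 'rV_(q i).+1 => u 0 r) (wi0 i); rewrite !mxE.
exists (fun i => w0^-1 *: w i); split=> [i|x].
  by apply: dual_coneZ; rewrite ?invr_ge0.
rewrite peval_lagrangian -subr_ge0 -(pmulr_rge0 _ w0_gt0).
apply: le_trans (w_lagr x) _; rewrite !mulrBr mulrDr.
have -> : w0 * (\sum_i \sum_r (w0^-1 *: w i) 0 r * peval (@g i r) x)
    = \sum_i \sum_r w i 0 r * peval (@g i r) x.
  rewrite mulr_sumr; apply: eq_bigr => i _; rewrite mulr_sumr; apply: eq_bigr => r _.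
  by rewrite mxE -mulrA mulVKf // gt_eqF.
rewrite -/(wg x); lra.
Qed.

Lemma pdeg_lagrangian w c :
  (pdeg (lagrangian w - mpolyC n c)%R <= max_degree f g)%N.
Proof.
pose small (p : mpoly n R) := (mmeasure mdeg p <= (max_degree f g).+1)%N.
have smallE (p : mpoly n R) : (pdeg p <= max_degree f g)%N = small p.
  by rewrite /pdeg /small; case: (mmeasure mdeg p).
have smallD p p' : small p -> small p' -> small (p + p').
  by move=> p_le p'_le; apply: leq_trans (mmeasureD_le _ _ _) _; rewrite geq_max; apply/andP.
have smallC e : small (mpolyC n e).
  by rewrite /small mmeasureC; case: eqP.
rewrite smallE -mpolyCN; apply: (smallD) => //; apply: (smallD).
  by rewrite -smallE leq_maxl.
have small0 : small 0 by rewrite -(mpolyC0 n R).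
apply: (big_ind small) => // i _; apply: (big_ind small) => // r _.
apply: leq_trans (msizeZ_le _ _) _; rewrite -/(small _) -smallE.
apply: leq_trans (leq_maxr _ _).
by rewrite (leq_trans _ (leq_bigmax i)) // (leq_bigmax r).
Qed.

Lemma weak_duality k mu w x :
  dual_feasible f t g k mu w -> primal_feasible t g x -> mu <= peval f x.
Proof.
move=> [[_ sosL] w1 w2 w3] xP.
have := peval_sos_ge0 x sosL.
rewrite {1}/peval mevalB mevalC subr_ge0 -/(peval _ _) -/(lagrangian w).
rewrite peval_lagrangian => /le_trans; apply; rewrite gerDl.
apply: sumr_le0 => i _; apply: (@dual_cone_pairing_le0 _ (t i)).
  by split; [exact: w1|exact: w2|exact: w3].
by move=> v; exact: xP.
Qed.

End Duality.

Theorem theorem3p2 (R : realType) (n m : nat) (f : mpoly n R)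
  (t q : 'I_m -> nat) (g : forall i : 'I_m, 'I_(q i).+1 -> mpoly n R)
  (k0 : nat)
  (f_sos_convex : sos_convex f)
  (le_t_q : forall i : 'I_m, (t i <= q i)%N)
  (g_sos_convex : forall (i : 'I_m) (r : 'I_(q i).+1),
     (r <= t i)%N -> sos_convex (g i r))
  (g_affine : forall (i : 'I_m) (r : 'I_(q i).+1),
     (t i < r)%N -> affine (g i r))
  (slater : primal_strictly_feasible t g !=set0)
  (k0_def : smallest_even_ge (max_degree f g) k0) :
  primal_inf f t g = dual_sup f t g k0 /\ dual_is_max f t g k0.
Proof.
have [_ deg_le _] := k0_def.
have le_primal mu x : dual_values f t g k0 mu -> primal_feasible t g x ->
    mu <= peval f x by move=> [w wP]; exact: weak_duality wP.
have dual_le : (dual_sup f t g k0 <= primal_inf f t g)%E.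
  apply: ge_ereal_sup => _ [mu muP <-]; apply: le_ereal_inf_tmp => _ [x xP <-].
  by rewrite lee_fin; exact: le_primal.
have attained c : primal_inf f t g = c%:E -> dual_values f t g k0 c.
  move=> infE; have [|w [wP wL]] :=
    lagrange_multipliers f_sos_convex g_sos_convex g_affine (c := c) slater.
    by move=> x xP; rewrite -lee_fin -infE; apply: ereal_inf_lbound; exists x.
  exists w; split; [split|by move=> i; case: (wP i)..].
    by apply: leq_trans deg_le; exact: pdeg_lagrangian.
  apply: sos_convex_ge0_is_sos => [|x].
    rewrite -mpolyCN; apply: sos_convexD; last exact: sos_convexC.
    exact: sos_convex_lagrangian wP.
  by rewrite {1}/peval mevalB mevalC subr_ge0; exact: wL.
have [xs xsP] := slater.
have primal_lt : (primal_inf f t g <= (peval f xs)%:E)%E.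
  by apply: ereal_inf_lbound; exists xs => // i v Vv; exact/ltW/xsP.
case infE : (primal_inf f t g) => [c| |].
- have dualE : dual_sup f t g k0 = c%:E.
    apply/eqP; rewrite eq_le -{1}infE dual_le.
    by apply: ereal_sup_ubound; exists c => //; exact: attained.
  by split=> // _; exists c => //; exact: attained.
- by move: primal_lt; rewrite infE leye_eq.
- have dualE : dual_sup f t g k0 = -oo%E.
    by apply/eqP; rewrite -leeNy_eq -infE.
  by split=> //; rewrite /dual_is_max dualE.
Qed.
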